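(* Let $\mathbb{D}$ be a division ring with an involution $x\mapsto x^\star$, and let $n\geq 2$ be an integer. Assume that $\operatorname{char}(\mathbb{D})=2$. Let $H:=\{x\in\mathbb{D} : x^\star=x\}$. Then for every root-linear mapping $\alpha : H \rightarrow \mathbb{D}$, the mapping $M \in \mathcal{H}_n(\mathbb{D}) \mapsto \Delta(M)^\alpha \in \mathbb{D}^n$ is a range-compatible homomorphism, and it is local only if $\alpha=0$.
   Context: Division rings are associative with unity $1\neq 0$ and not assumed commutative. An involution of $\mathbb{D}$ is an endomorphism $x\mapsto x^\star$ of the group $(\mathbb{D},+)$ with $(xy)^\star=y^\star x^\star$ and $(x^\star)^\star=x$ for all $x,y$ (the identity is allowed when $\mathbb{D}$ is commutative). For $M=(m_{i,j})\in \mathrm{M}_n(\mathbb{D})$, set $M^\star:=(m_{j,i}^\star)$; $\mathcal{H}_n(\mathbb{D})$ denotes the additive group of all $M \in \mathrm{M}_n(\mathbb{D})$ with $M^\star=M$ (so its diagonal entries lie in $H$). A mapping $\alpha:H\to\mathbb{D}$ is root-linear if it is a homomorphism of additive groups and $\alpha(xax^\star)=x\,\alpha(a)$ for all $(x,a)\in\mathbb{D}\times H$. For $M=(m_{i,j})\in\mathrm{M}_n(\mathbb{D})$, $\Delta(M):=\begin{bmatrix} m_{1,1} & \cdots & m_{n,n}\end{bmatrix}^T\in\mathbb{D}^n$. For $X=(x_1,\dots,x_n)\in H^n$ and a mapping $f$ with source $H$, $X^f:=(f(x_1),\dots,f(x_n))$. $\mathbb{D}^n$ is identified with the column matrices with $n$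 rows and is viewed as a right $\mathbb{D}$-vector space. The range of a matrix $M\in \mathrm{M}_n(\mathbb{D})$ is the right $\mathbb{D}$-linear span of its columns in $\mathbb{D}^n$. For an additive subgroup $\mathcal{M}$ of $\mathrm{M}_n(\mathbb{D})$, a range-compatible homomorphism on $\mathcal{M}$ is a group homomorphism $F:(\mathcal{M},+)\to(\mathbb{D}^n,+)$ such that $F(M)$ belongs to the range of $M$ for all $M\in\mathcal{M}$. A mapping $F:\mathcal{M}\to\mathbb{D}^n$ is local if there exists $X\in\mathbb{D}^n$ such that $F(M)=MX$ for all $M\in\mathcal{M}$. *)

(* Defs.v *)
From HB Require Import structures.
From mathcomp Require Import all_boot all_order all_algebra.

Set Implicit Arguments.
Unset Strict Implicit.
Unset Printing Implicit Defensive.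

Import GRing.Theory.
Local Open Scope ring_scope.

(* A unitRingType is an associative ring, not assumed commutative, with
   1 != 0. *)
Definition is_division_ring (D : unitRingType) : Prop :=
  forall x : D, x != 0 -> x \is a GRing.unit.

Record involution (D : nzRingType) := Involution {
  star_fun :> {additive D -> D};
  starM : forall x y : D, star_fun (x * y) = star_fun y * star_fun x;
  starK : forall x : D, star_fun (star_fun x) = x
}.

Definition is_symmetric (D : nzRingType) (star : involution D) : {pred D} :=
  fun x => star x == x.

Fact is_symmetric_zmod_closed (D : nzRingType) (star : involution D) :
  zmod_closed (is_symmetric star).
Proof.
split=> [|x y]; rewrite !unfold_in ?raddf0 // => /eqP Ex /eqP Ey.
by rewrite raddfB Ex Ey.
Qed.

HB.instance Definition _ (D : nzRingType) (star : involution D) :=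
  GRing.isZmodClosed.Build D (is_symmetric star)
    (is_symmetric_zmod_closed star).

(* The additive group H of the elements fixed by the involution. *)
Record symmetric_elt (D : nzRingType) (star : involution D) := SymmetricElt {
  symmetric_val : D;
  symmetricP : symmetric_val \in is_symmetric star
}.

HB.instance Definition _ (D : nzRingType) (star : involution D) :=
  [isSub for @symmetric_val D star].
HB.instance Definition _ (D : nzRingType) (star : involution D) :=
  [Choice of symmetric_elt star by <:].
HB.instance Definition _ (D : nzRingType) (star : involution D) :=
  [SubChoice_isSubZmodule of symmetric_elt star by <:].

Fact symmetric_conj_subproof (D : nzRingType) (star : involution D)
    (x : D) (a : symmetric_elt star) : x * val a * star x \in is_symmetric star.
Proof.
have /eqP Ea : star (val a) == val a := symmetricP a.
by rewrite unfold_in !starM starK Ea mulrA.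
Qed.

Definition symmetric_conj (D : nzRingType) (star : involution D)
    (x : D) (a : symmetric_elt star) : symmetric_elt star :=
  SymmetricElt (symmetric_conj_subproof x a).

Definition root_linear (D : nzRingType) (star : involution D)
    (alpha : symmetric_elt star -> D) : Prop :=
  {morph alpha : a b / a + b} /\
  forall (x : D) (a : symmetric_elt star),
    alpha (symmetric_conj x a) = x * alpha a.

Definition star_mx (D : nzRingType) (star : involution D) (n : nat)
    (M : 'M[D]_n) : 'M[D]_n :=
  \matrix_(i, j) star (M j i).

Definition is_hermitian (D : nzRingType) (star : involution D) (n : nat) :
  {pred 'M[D]_n} := fun M => star_mx star M == M.

Fact is_hermitian_zmod_closed (D : nzRingType) (star : involution D)
  (n : nat) : zmod_closed (@is_hermitian D star n).
Proof.
split=> [|M N]; rewrite !unfold_in.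
  by apply/eqP/matrixP=> i j; rewrite !mxE raddf0.
move=> /eqP/matrixP EM /eqP/matrixP EN; apply/eqP/matrixP=> i j.
move: (EM i j) (EN i j); rewrite !mxE => EMij ENij.
by rewrite raddfB EMij ENij.
Qed.

HB.instance Definition _ (D : nzRingType) (star : involution D) (n : nat) :=
  GRing.isZmodClosed.Build 'M[D]_n (@is_hermitian D star n)
    (@is_hermitian_zmod_closed D star n).

(* The additive group H_n(D). *)
Record hermitian_mx (D : nzRingType) (star : involution D) (n : nat) :=
  HermitianMx {
    hermitian_val : 'M[D]_n;
    hermitianP : hermitian_val \in @is_hermitian D star n
  }.

HB.instance Definition _ (D : nzRingType) (star : involution D) (n : nat) :=
  [isSub for @hermitian_val D star n].
HB.instance Definition _ (D : nzRingType) (star : involution D) (n : nat) :=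
  [Choice of hermitian_mx star n by <:].
HB.instance Definition _ (D : nzRingType) (star : involution D) (n : nat) :=
  [SubChoice_isSubZmodule of hermitian_mx star n by <:].

Definition diag_vector (T : Type) (n : nat) (M : 'M[T]_n) : 'cV[T]_n :=
  \col_i M i i.

Fact hermitian_diag_subproof (D : nzRingType) (star : involution D) (n : nat)
    (M : hermitian_mx star n) (i : 'I_n) :
  diag_vector (val M) i 0 \in is_symmetric star.
Proof.
have /eqP/matrixP/(_ i i) := hermitianP M.
by rewrite unfold_in !mxE => ->.
Qed.

(* diag_vector (val M), with its entries regarded as elements of H. *)
Definition hermitian_diag (D : nzRingType) (star : involution D) (n : nat)
    (M : hermitian_mx star n) : 'cV[symmetric_elt star]_n :=
  \col_i SymmetricElt (hermitian_diag_subproof M i).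

(* The map sending M to Delta(M)^alpha. *)
Definition diag_map (D : nzRingType) (star : involution D) (n : nat)
    (alpha : symmetric_elt star -> D) (M : hermitian_mx star n) : 'cV[D]_n :=
  map_mx alpha (hermitian_diag M).

(* D^n as a right D-vector space: the *: of matrices is multiplication on the
   left, hence the separate operation. *)
Definition rscale (D : nzRingType) (n : nat) (v : 'cV[D]_n) (x : D) :
  'cV[D]_n := \col_i (v i 0 * x).

Definition in_right_range (D : nzRingType) (n : nat) (M : 'M[D]_n)
    (v : 'cV[D]_n) : Prop :=
  exists c : 'I_n -> D, v = \sum_j rscale (col j M) (c j).

(* An additive subgroup of M_n(D) is represented by a subZmodType S. *)
Definition range_compatible_hom (D : nzRingType) (n : nat)
    (P : pred 'M[D]_n) (S : subZmodType P) (F : S -> 'cV[D]_n) : Prop :=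
  {morph F : M N / M + N} /\ forall M : S, in_right_range (val M) (F M).

Definition local_map (D : nzRingType) (n : nat)
    (P : pred 'M[D]_n) (S : subZmodType P) (F : S -> 'cV[D]_n) : Prop :=
  exists X : 'cV[D]_n, forall M : S, F M = val M *m X.

(* Main.v *)
(** Taking a = 1 in alpha ((1 + x) a (1 + x)^* ) = (1 + x) alpha a shows that
    alpha kills every trace z + z^*.  If y is a row with y M = 0, then
    0 = y M y^* is the sum of the y_i m_ii y_i^* and of a trace, so applying
    alpha yields sum_i y_i alpha(m_ii) = 0.  Hence the vector Delta(M)^alpha is
    annihilated by every row annihilating M, and over a division ring this
    puts it in the range of M.  If the map is M |-> M X, the matrix
    E_01 + E_10 forces X_1 = 0, and then a I_n forces alpha(a) = a X_1 = 0. *)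
Require Import Defs.
From mathcomp Require Import all_boot all_order all_algebra.

Set Implicit Arguments.
Unset Strict Implicit.
Unset Printing Implicit Defensive.

Import GRing.Theory.
Local Open Scope ring_scope.

(** A nonzero column has an invertible entry, whence a row [r] with [r *m a = 1]. In all cases
    [a *m r] is then a projection onto the right span of [a]. *)
Lemma column_quasi_inverse (D : unitRingType) (divD : is_division_ring D)
    (m : nat) (a : 'cV[D]_m) : exists r : 'rV[D]_m, a *m (r *m a) = a.
Proof.
have [->|/cV0Pn[i ai_neq0]] := eqVneq a 0.
  by exists 0; rewrite mul0mx.
exists ((a i 0)^-1 *: delta_mx 0 i).
rewrite -scalemxAl -rowE [_ *: _]mx11_scalar !mxE mulVr ?divD //.
exact: mulmx1.
Qed.

(** Fredholm alternative, by induction on the number of columns: the first column is projected away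
    and the system that remains has one unknown fewer. *)
Lemma mulmx_solvable_or (D : unitRingType) (divD : is_division_ring D)
    (m n : nat) (A : 'M[D]_(m, n)) (v : 'cV[D]_m) :
  (exists c : 'cV[D]_n, A *m c = v) \/
  (exists2 y : 'rV[D]_m, y *m A = 0 & y *m v != 0).
Proof.
elim: n A v => [|n IHn] A v.
  have [->|/cV0Pn[i vi_neq0]] := eqVneq v 0.
    by left; exists 0; rewrite mulmx0.
  (* Without columns every row annihilates [A], so selecting a nonzero entry of [v] suffices. *)
  right; exists (delta_mx 0 i); first exact: thinmx0.
  rewrite -rowE; apply: contraNneq vi_neq0 => /matrixP/(_ 0 0).
  by rewrite !mxE => ->.
rewrite -(hsubmxK (A : 'M_(m, 1 + n))); set a := lsubmx _; set B := rsubmx _.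
have [r ara] := column_quasi_inverse divD a.
(* P kills the column a, and ker P is contained in its span. *)
pose P : 'M[D]_m := 1%:M - a *m r.
have Pa : P *m a = 0 by rewrite mulmxBl mul1mx -mulmxA ara subrr.
have [[c /eqP]|[y yPB yPv]] := IHn (P *m B) (P *m v).
  (* [P *m (v - B *m c) = 0] unfolds to [v - B *m c = a *m (r *m (v - B *m c))], which gives the
     coefficient of the column [a]. *)
  rewrite -mulmxA eq_sym -subr_eq0 -mulmxBr mulmxBl mul1mx -mulmxA subr_eq0.
  move=> /eqP vBc; left; exists (col_mx (r *m (v - B *m c)) c).
  by rewrite (mul_row_col a B) -vBc subrK.
right; exists (y *m P); last by rewrite -mulmxA.
by rewrite (mul_mx_row (y *m P) a B) -!mulmxA Pa mulmx0 yPB row_mx0.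
Qed.

(** Meant for an [F] whose indices are swapped by the involution: the last two sums are then some
    [z] and [star z], so together they form a trace. *)
Lemma sum_diag_offdiag (V : zmodType) (n : nat) (F : 'I_n -> 'I_n -> V) :
  \sum_i \sum_j F i j =
  \sum_i F i i + (\sum_(i < n) \sum_(j < n | (j < i)%N) F i j
                  + \sum_(i < n) \sum_(j < n | (j < i)%N) F j i).
Proof.
rewrite [X in _ + (_ + X)](exchange_big_dep predT) //= -!big_split /=.
apply: eq_bigr => i _.
rewrite (bigD1 i) //=; congr (_ + _).
rewrite (bigID (fun j : 'I_n => (j < i)%N)) /=; congr (_ + _).
  by apply: eq_bigl => j; rewrite -val_eqE /=; case: ltngtP.
by apply: eq_bigl => j; rewrite -val_eqE /=; case: ltngtP.
Qed.

Section Involution.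

Variables (D : nzRingType) (star : involution D).

Lemma star1 : star 1 = 1.
Proof. by have := starM star 1 (star 1); rewrite mul1r !starK mul1r. Qed.

Fact symmetric1 : 1 \in is_symmetric star.
Proof. by rewrite unfold_in star1. Qed.

Fact symmetric_trace_subproof (z : D) : z + star z \in is_symmetric star.
Proof. by rewrite unfold_in raddfD starK addrC. Qed.

Definition symmetric_trace (z : D) : symmetric_elt star :=
  SymmetricElt (symmetric_trace_subproof z).

Lemma val_hermitian_diag (n : nat) (M : hermitian_mx star n) i j :
  val (hermitian_diag M i j) = val M i i.
Proof. by rewrite !mxE /= mxE. Qed.

Variables (alpha : symmetric_elt star -> D) (alphaP : root_linear alpha).

Lemma root_linear0 : alpha 0 = 0.
Proof. by apply: (addrI (alpha 0)); rewrite -alphaP.1 !addr0. Qed.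

Lemma root_linear_sum (I : finType) (F : I -> symmetric_elt star) :
  alpha (\sum_i F i) = \sum_i alpha (F i).
Proof. exact: (big_morph alpha alphaP.1 root_linear0). Qed.

Lemma root_linear_trace (z : D) : alpha (symmetric_trace z) = 0.
Proof.
pose e : symmetric_elt star := SymmetricElt symmetric1.
have : symmetric_conj (1 + z) e = e + symmetric_trace z + symmetric_conj z e.
  apply: val_inj; rewrite !raddfD /= !mulr1 raddfD star1.
  by rewrite mulrDl mul1r mulrDr mulr1 !addrA [1 + _ + z]addrAC.
(* Both sides contain [alpha e + z * alpha e]; cancelling it leaves only the trace term. *)
move/(congr1 alpha); rewrite !alphaP.1 !alphaP.2 mulrDl mul1r => /addIr.
by rewrite -{1}[alpha e]addr0 => /addrI.
Qed.

Lemma diag_mapE (n : nat) (M : hermitian_mx star n) i j :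
  diag_map alpha M i j = alpha (hermitian_diag M i j).
Proof. exact: mxE. Qed.

Lemma mul_diag_map_eq0 (n : nat) (M : hermitian_mx star n) (y : 'rV[D]_n) :
  y *m val M = 0 -> y *m diag_map alpha M = 0.
Proof.
move=> yM0; apply/matrixP => i0 j0; rewrite !ord1 !mxE {i0 j0}.
pose F i j := y 0 i * val M i j * star (y 0 j).
pose z := \sum_(i < n) \sum_(j < n | (j < i)%N) F i j.
have starF i j : star (F i j) = F j i.
  have /eqP/matrixP/(_ j i) := hermitianP M.
  by rewrite !starM starK mxE mulrA /F => ->.
have starz : star z = \sum_(i < n) \sum_(j < n | (j < i)%N) F j i.
  rewrite raddf_sum; apply: eq_bigr => i _.
  by rewrite raddf_sum; apply: eq_bigr => j _.
have sumF : \sum_i \sum_j F i j = 0.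
  (* Summing over the row index first brings out the entry [j] of [y *m val M], which is zero. *)
  rewrite exchange_big big1 // => j _; rewrite -mulr_suml.
  by move/matrixP/(_ 0 j): yM0; rewrite !mxE => ->; rewrite mul0r.
pose d i := symmetric_conj (y 0 i) (hermitian_diag M i 0).
(* The vanishing of y M y^* is lifted from [D] to H, where [alpha] can be applied. *)
have dz : \sum_i d i + symmetric_trace z = 0.
  apply: val_inj; rewrite raddfD raddf_sum raddf0 /= starz.
  rewrite -[RHS]sumF sum_diag_offdiag; congr (_ + _); apply: eq_bigr => i _.
  by rewrite /= !mxE /= !mxE.
move/(congr1 alpha): dz.
rewrite alphaP.1 root_linear_trace addr0 root_linear_sum root_linear0 => sum0.
by rewrite -[RHS]sum0; apply: eq_bigr => i _; rewrite alphaP.2 mxE.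
Qed.

End Involution.

Lemma in_right_range_mulmx (D : nzRingType) (n : nat) (M : 'M[D]_n)
    (c : 'cV[D]_n) : in_right_range M (M *m c).
Proof.
exists (fun j => c j 0); apply/colP => i; rewrite mxE summxE.
by apply: eq_bigr => j _; rewrite !mxE.
Qed.

Fact scalar_hermitian (D : nzRingType) (star : involution D) (n : nat)
    (a : symmetric_elt star) : (val a)%:M \in @is_hermitian D star n.
Proof.
rewrite unfold_in; apply/eqP/matrixP => i j; rewrite !mxE eq_sym.
by case: eqP => _; rewrite ?raddf0 //; exact/eqP/(symmetricP a).
Qed.

Fact delta_swap_hermitian (D : nzRingType) (star : involution D) (n : nat)
    (i j : 'I_n) :
  delta_mx i j + delta_mx j i \in @is_hermitian D star n.
Proof.
rewrite unfold_in; apply/eqP/matrixP => k l; rewrite !mxE raddfD addrC.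
rewrite [(l == j) && _]andbC [(l == i) && _]andbC.
by do 2!case: (_ && _); rewrite ?raddf0 ?star1.
Qed.

Theorem theorem1p4 (D : unitRingType) (divD : is_division_ring D)
    (star : involution D) (n : nat) (n_ge2 : (2 <= n)%N)
    (char2 : 2%N \in [pchar D])
    (alpha : symmetric_elt star -> D) (alphaP : root_linear alpha) :
  range_compatible_hom (S := hermitian_mx star n) (diag_map (n := n) alpha) /\
  (local_map (S := hermitian_mx star n) (diag_map (n := n) alpha) ->
   forall a : symmetric_elt star, alpha a = 0).
Proof.
split; first split.
- move=> M N; apply/matrixP => i j; rewrite [RHS]mxE !diag_mapE -alphaP.1.
  congr alpha; apply: val_inj.
  by rewrite GRing.valD !val_hermitian_diag GRing.valD mxE.
- move=> M.
  have [[c <-]|[y yM]] := mulmx_solvable_or divD (val M) (diag_map alpha M).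
    exact: in_right_range_mulmx.
  (* A row annihilating M also annihilates the image vector, so the second alternative is absurd. *)
  by rewrite mul_diag_map_eq0 ?eqxx.
case=> X alphaX a.
pose i0 : 'I_n := Ordinal (ltnW n_ge2); pose i1 : 'I_n := Ordinal n_ge2.
have X1 : X i1 0 = 0.
  pose E01 := Defs.HermitianMx (delta_swap_hermitian star i0 i1).
  have diag0 : hermitian_diag E01 i0 0 = 0.
    by apply: val_inj; rewrite val_hermitian_diag GRing.val0 !mxE addr0.
  (* At row [i0] the left side is [alpha 0], and the only nonzero entry of [E01] there, a 1 in
     column [i1], selects [X i1 0]. *)
  have /colP/(_ i0) := alphaX E01; rewrite diag_mapE diag0 root_linear0 //.
  rewrite [RHS]mxE (bigD1 i1) //= big1 => [|j j_neq1]; last first.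
    by rewrite !mxE (negPf j_neq1) andbF addr0 mul0r.
  by rewrite !mxE !eqxx /= !addr0 mul1r => <-.
have /colP/(_ i1) := alphaX (Defs.HermitianMx (scalar_hermitian n a)).
rewrite diag_mapE mul_scalar_mx [RHS]mxE X1 mulr0 => <-.
by congr alpha; apply: val_inj; rewrite val_hermitian_diag mxE eqxx.
Qed.
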